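(* Let $A\in R(\Omega)$, with associated sequences $(a_n),(b_n),(c_n),(d_n)$ having limits $a,b,c,d$. Let $\alpha\in\mathbb N$, $w\in\Omega$, suppose that the involution kernel of $A$ based at $x'=0^\alpha1w$ exists, and let $A^*$ be the associated dual potential. Then, writing a point $y\in\Omega^-$ as the sequence $y_1y_2y_3\dots$, for all $n\in\mathbb N$ and $z\in\Omega$: - $A^*(0^\infty)=a$; - $A^*(0^{n+1}1z)=a_{\alpha+n+1}+(d_{\alpha+n+1}-d_{\alpha+n})$; - $A^*(01^n0z)=a_{\alpha+1}+(d_{\alpha+1}-d_\alpha)$; - $A^*(01^\infty)=a_{\alpha+1}+(d_{\alpha+1}-d_\alpha)$; - $A^*(1^\infty)=c$; - $A^*(1^{n+1}0z)=c_{n+1}+b_{n+1}-b_n$; - $A^*(10^n1z)=d_\alpha+(b_1-a_{\alpha+1})+\sum_{j=2}^n(a_j-a_{\alpha+j})+(d_n-d_{\alpha+n})$; - $A^*(10^\infty)=d_\alpha+(b_1-a_{\alpha+1})+\sum_{j=2}^\infty(a_j-a_{\alpha+j})$.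
   Context: $\mathbb N=\{1,2,\dots\}$, $\Omega=\{0,1\}^{\mathbb N}$ with the product topology. $\Omega^-$ is a copy of $\Omega$ whose points are written $y=(y_1,y_2,\dots)$; $\hat\Omega=\Omega^-\times\Omega$, with points $(y|x)=(\dots,y_2,y_1|x_1,x_2,\dots)$. The Walters family $R(\Omega)$ is the set of continuous $A:\Omega\to\mathbb R$ for which there are convergent real sequences $(a_n),(b_n),(c_n),(d_n)$ such that for all $n\in\mathbb N$, $v\in\Omega$: $A(0^{n+1}1v)=a_{n+1}$, $A(01^n0v)=b_n$, $A(1^{n+1}0v)=c_{n+1}$, $A(10^n1v)=d_n$. The involution kernel of $A$ based at $x'\in\Omega$ is $W(y|x)=\sum_{n\ge1}[A(y_n,\dots,y_1,x_1,x_2,\dots)-A(y_n,\dots,y_1,x'_1,x'_2,\dots)]$; it exists if this series converges for every $(y|x)\in\hat\Omega$. The associated dual potential $A^*:\Omega^-\to\mathbb R$ is $$A^*(y)=A(y_1,x_1,x_2,\dots)+W\big((y_2,y_3,\dots)\,|\,(y_1,x_1,x_2,\dots)\big)-W(y|x),$$ whose right-hand side does not depend on $x\in\Omega$. *)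

(* Defs.v *)
From HB Require Import structures.
From mathcomp Require Import all_boot all_order all_algebra.
From mathcomp Require Import ring.
From mathcomp Require Import all_classical all_reals all_analysis.

Set Implicit Arguments.
Unset Strict Implicit.
Unset Printing Implicit Defensive.

Import Order.TTheory GRing.Theory Num.Theory.
Import numFieldNormedType.Exports.

Local Open Scope classical_set_scope.
Local Open Scope ring_scope.

(* Sequences of symbols are indexed from 0 here: [x i] is x_{i+1},
   and false, true stand for the symbols 0, 1.  [cantor_space] carries the
   product topology.  The copy Omega^- is the same type, a point of it being
   written y = (y_1, y_2, ...); a point (y|x) is passed as two arguments. *)
Notation Omega := cantor_space.

Definition prepend (s : seq bool) (v : Omega) : Omega :=
  fun i => if (i < size s)%N then nth false s i else v (i - size s)%N.

Definition const_word (e : bool) : Omega := fun=> e.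

Definition tail (y : Omega) : Omega := fun i => y i.+1.

(* The point (y_n, ..., y_1, x_1, x_2, ...). *)
Definition glue (n : nat) (y x : Omega) : Omega := prepend (rev (mkseq y n)) x.

Section Potentials.
Context {R : realType}.
Implicit Types (A : Omega -> R) (a b c d : nat -> R) (x y : Omega).

(* Real sequences (a_n) with n >= 1 are functions on nat whose value at 0 is
   irrelevant.  The values a 1 and c 1 are not constrained by A. *)
Definition walters_sequences A a b c d : Prop :=
  forall (n : nat) (v : Omega), (0 < n)%N ->
  [/\ A (prepend (nseq n.+1 false ++ [:: true]) v) = a n.+1,
      A (prepend (false :: nseq n true ++ [:: false]) v) = b n,
      A (prepend (nseq n.+1 true ++ [:: false]) v) = c n.+1 &
      A (prepend (true :: nseq n false ++ [:: true]) v) = d n].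

Definition walters_family : set (Omega -> R) :=
  [set A | continuous A /\
    exists a b c d, [/\ cvgn a, cvgn b, cvgn c & cvgn d] /\
      walters_sequences A a b c d].

Definition kernel_partial_sum A x' y x (N : nat) : R :=
  \sum_(1 <= n < N) (A (glue n y x) - A (glue n y x')).

Definition involution_kernel_exists A x' : Prop :=
  forall y x, cvgn (kernel_partial_sum A x' y x).

Definition involution_kernel A x' y x : R :=
  limn (kernel_partial_sum A x' y x).

Definition dual_rhs A x' y x : R :=
  let y1x := prepend [:: y 0%N] x in
  A y1x + involution_kernel A x' (tail y) y1x - involution_kernel A x' y x.

Definition is_dual_potential A x' (Astar : Omega -> R) : Prop :=
  forall y x, Astar y = dual_rhs A x' y x.

Lemma glue1 y x : glue 1 y x = prepend [:: y 0%N] x.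
Proof. by []. Qed.

Lemma glue_tail n y x : glue n (tail y) (prepend [:: y 0%N] x) = glue n.+1 y x.
Proof.
apply/funext => i; rewrite /glue /prepend !size_rev !size_mkseq /=.
have -> : mkseq y n.+1 = y 0%N :: mkseq (tail y) n.
  by rewrite /mkseq /= -[1%N]addn0 iotaDl -map_comp.
rewrite rev_cons nth_rcons size_rev size_mkseq.
case: (ltngtP i n) => [lt_in|lt_ni|->]; last by rewrite subnn !ltnSn.
- by rewrite ltnS ltnW.
- by rewrite !ltnS leqn0 subn_eq0 leqNgt lt_ni /= subn1 subnS.
Qed.

(* The right-hand side does not depend on x, so that the dual potential is
   well defined (and clearly unique) as soon as the involution kernel exists. *)
Lemma dual_potential_exists A x' :
  involution_kernel_exists A x' -> exists Astar, is_dual_potential A x' Astar.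
Proof.
move=> kx; pose K y N : R := \sum_(1 <= n < N.+2) A (glue n y x') -
  \sum_(1 <= n < N.+1) A (glue n (tail y) x').
exists (fun y => limn (K y)) => y x; rewrite /dual_rhs -glue1.
set y1x := glue 1 y x; apply/cvg_lim => //.
have -> : K y = fun N => A y1x + kernel_partial_sum A x' (tail y) y1x N.+1
    - kernel_partial_sum A x' y x N.+2.
  apply/funext => N; rewrite /K /kernel_partial_sum !sumrB.
  have -> : \sum_(1 <= n < N.+1) A (glue n (tail y) y1x) =
            \sum_(1 <= n < N.+2) A (glue n y x) - A y1x.
    rewrite [in RHS]big_nat_recl // addrAC subrr add0r.
    by apply: eq_bigr => n _; rewrite /y1x glue1 glue_tail.
  by rewrite !opprB; ring.
apply: cvgB; first apply: cvgD; first exact: cvg_cst.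
- have := kx (tail y) y1x; by rewrite -cvg_shiftS.
- have := kx y x; rewrite -(cvg_shiftn 2).
  by under eq_fun do rewrite addn2.
Qed.

End Potentials.

(* Main.v *)
Require Import Defs.
From mathcomp Require Import all_boot all_order all_algebra.
From mathcomp Require Import zify.
From mathcomp Require Import all_classical all_reals all_analysis.
Import Order.TTheory GRing.Theory Num.Theory.
Import numFieldNormedType.Exports.
Local Open Scope classical_set_scope.
Local Open Scope ring_scope.

(* Since W(.|x') = 0, evaluating the dual potential at x = x' gives
   A*(y) = A(y_1 x') + sum_{k >= 1} [A(y_{k+1} .. y_1 x') - A(y_{k+1} .. y_2 x')].
   The value of A at a point is determined by its first run, or by its first two
   runs when the first one is a single letter.  Hence a term vanishes once the two
   points share such a beginning: only finitely many survive when y changes letter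
   after y_2, and along a constant initial run of y the sum telescopes. *)

Set Implicit Arguments.
Unset Strict Implicit.
Unset Printing Implicit Defensive.

(* The library's [functions.glue] shadows the one of Defs. *)
Local Notation glue := Defs.glue.

(** * Letters of prefixed and glued points *)

Lemma prependE (s : seq bool) (v : Omega) (i : nat) :
  (prepend s v : nat -> bool) i =
  if (i < size s)%N then nth false s i else v (i - size s)%N.
Proof. by []. Qed.

(** Turns letterwise knowledge of a point into the form in which [walters_sequences] evaluates
    [A]. *)
Lemma prepend_prefix (s : seq bool) (x : Omega) :
  (forall i, (i < size s)%N -> x i = nth false s i) ->
  exists v : Omega, x = prepend s v.
Proof.
move=> xs; exists (fun i => x (size s + i)%N); apply/funext => i.
rewrite prependE; case: ltnP => [/xs //|le_si].
by rewrite subnKC.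
Qed.

Lemma glueE (n : nat) (y x : Omega) (i : nat) :
  (glue n y x : nat -> bool) i =
  if (i < n)%N then y (n - i.+1)%N else x (i - n)%N.
Proof.
rewrite /glue prependE size_rev size_mkseq; case: ltnP => // lt_in.
by rewrite seq.nth_rev ?size_mkseq ?nth_mkseq ?size_mkseq //; lia.
Qed.

Lemma prepend_runE (n : nat) (e : bool) (v : Omega) :
  (forall i, (i < n)%N -> (prepend (nseq n e ++ [:: ~~ e]) v : nat -> bool) i = e)
  /\ (prepend (nseq n e ++ [:: ~~ e]) v : nat -> bool) n = ~~ e.
Proof.
split=> [i lt_in|]; rewrite prependE size_cat size_nseq addn1 ltnS.
  by rewrite ltnW // nth_cat size_nseq lt_in nth_nseq lt_in.
by rewrite leqnn nth_cat size_nseq ltnn subnn.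
Qed.

(** * Potentials determined by the first one or two runs *)

Section WaltersValues.
Context {R : realType}.
Variables (A : Omega -> R) (a b c d : nat -> R).
Hypothesis wA : walters_sequences A a b c d.
Implicit Types (x y : Omega) (e : bool) (n m : nat).

(** Length one is excluded: the value then depends on the second run, and [a 1], [c 1] are
    unconstrained. *)
Lemma walters_first_run x n e : (1 < n)%N ->
  (forall i, (i < n)%N -> x i = e) -> x n = ~~ e ->
  A x = (if e then c else a) n.
Proof.
case: n => [//|n]; rewrite ltnS => n_gt0 xe xn.
have [v ->] : exists v, x = prepend (nseq n.+1 e ++ [:: ~~ e]) v.
  apply: prepend_prefix => i; rewrite size_cat size_nseq addn1 ltnS => le_in.
  rewrite nth_cat size_nseq nth_nseq; case: ltnP => [lt_in|ge_in]; first exact: xe.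
  have -> : i = n.+1 by lia.
  by rewrite subnn xn.
by case: e xe xn => _ _; have [] := wA v n_gt0.
Qed.

Lemma walters_second_run x n e : (0 < n)%N ->
  x 0%N = e -> (forall i, (i < n)%N -> x i.+1 = ~~ e) -> x n.+1 = e ->
  A x = (if e then d else b) n.
Proof.
move=> n_gt0 x0 xe xn.
have [v ->] : exists v, x = prepend (e :: nseq n (~~ e) ++ [:: e]) v.
  apply: prepend_prefix => -[//|i] /=; rewrite size_cat size_nseq addn1 !ltnS => le_in.
  rewrite nth_cat size_nseq nth_nseq; case: ltnP => [lt_in|ge_in]; first exact: xe.
  have -> : i = n by lia.
  by rewrite subnn xn.
by case: e {x0} xe xn => _ _; have [] := wA v n_gt0.
Qed.

(* A change of letter after position 0 ends the first run, and the second one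
   if the first is a single letter. *)
Lemma walters_local x y m : (0 < m)%N -> x m.+1 = ~~ x m ->
  (forall i, (i <= m.+1)%N -> x i = y i) -> A x = A y.
Proof.
move=> m_gt0 xm xy.
(* [p] is the length of the first run; [p <= m.+1] because [x m] and [x m.+1] cannot both equal
   [x 0]. *)
have [p [p_gt0 le_pm xp x_lt_p]] : exists p, [/\ (0 < p)%N, (p <= m.+1)%N,
    x p = ~~ x 0%N & forall i, (i < p)%N -> x i = x 0%N].
  have ex_p : exists p, x p != x 0%N.
    by case: (x m =P x 0%N) xm => [->|/eqP] xm; [exists m.+1; rewrite xm; case: (x _)|exists m].
  have [p xp min_p] := ex_minnP ex_p; exists p; split.
  - by case: p xp {min_p} => //; rewrite eqxx.
  - case: (x m =P x 0%N) xm => [->|/eqP xm0] xm.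
      by apply: min_p; rewrite xm; case: (x _).
    by rewrite (leq_trans (min_p _ xm0)).
  - by move: xp; case: (x p); case: (x 0%N).
  - by move=> i lt_ip; apply/eqP/negPn/negP => /min_p; rewrite leqNgt lt_ip.
case: (ltnP 1 p) => [p_gt1|p_le1].
  rewrite (walters_first_run p_gt1 x_lt_p xp) -(walters_first_run (x := y) p_gt1) //.
    by move=> i lt_ip; rewrite -xy ?x_lt_p //; lia.
  by rewrite -xy.
have {xp p p_gt0 p_le1 le_pm x_lt_p} x1 : x 1%N = ~~ x 0%N.
  by rewrite -xp; congr (x _); lia.
(* The first run is now a single letter, and the least [q] with [Q q] is the length of the second
   run. *)
pose Q q := (0 < q)%N && (x q.+1 == x 0%N).
have [q0 [le_q0 Qq0]] : exists q, (q <= m)%N /\ Q q.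
  (* If [x m.+1] differs from [x 0], then [x m] equals it and the witness is [m - 1], positive
     because [x 1] differs from [x 0]. *)
  case: (x m.+1 =P x 0%N) => [xm0|/eqP xm0].
    by exists m; rewrite /Q m_gt0 xm0 eqxx.
  have xmE : x m = x 0%N by move: xm xm0; case: (x m.+1); case: (x m); case: (x 0%N).
  case: m m_gt0 xm xmE {xy xm0} => [//|[|m]] _ xm xmE.
    by move: x1; rewrite xmE; case: (x _).
  by exists m.+1; rewrite /Q /= xmE eqxx.
have [q /andP[q_gt0 /eqP xq] min_q] := ex_minnP (ex_intro Q _ Qq0).
have le_qm : (q <= m)%N by rewrite (leq_trans _ le_q0) ?min_q.
have x_lt_q i : (i < q)%N -> x i.+1 = ~~ x 0%N.
  case: i => [//|i] lt_iq; case: (x i.+2 =P x 0%N) => [xi|].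
    by have := min_q i.+1; rewrite /Q xi eqxx => /(_ isT); lia.
  by case: (x i.+2); case: (x 0%N).
rewrite (walters_second_run q_gt0 (erefl _) x_lt_q xq).
rewrite -(walters_second_run (x := y) q_gt0) -?xy //.
by move=> i lt_iq; rewrite -xy ?x_lt_q //; lia.
Qed.

End WaltersValues.

(** * The dual potential as a series at the base point *)

Section DualPotential.
Context {R : realType}.
Variables (A : Omega -> R) (x' : Omega) (Astar : Omega -> R).
Hypothesis kerA : involution_kernel_exists A x'.
Hypothesis dualA : is_dual_potential A x' Astar.
Implicit Types y : Omega.

Definition dual_term y k : R :=
  A (glue k.+1 y x') - A (glue k (tail y) x').

Lemma involution_kernel_base y : involution_kernel A x' y x' = 0.
Proof.
rewrite /involution_kernel (_ : kernel_partial_sum _ _ _ _ = fun=> 0) ?lim_cst//.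
by apply/funext => N; apply: big1 => n _; rewrite subrr.
Qed.

Lemma dual_potential_cvg y :
  (fun N => A (glue 1 y x') + \sum_(1 <= k < N) dual_term y k) @ \oo --> Astar y.
Proof.
rewrite (dualA y x') /dual_rhs involution_kernel_base subr0 Defs.glue1.
apply: cvgD; first exact: cvg_cst.
rewrite (_ : (fun N => _) = kernel_partial_sum A x' (tail y) (prepend [:: y 0%N] x')).
  exact: kerA.
by apply/funext => N; apply: eq_bigr => k _; rewrite glue_tail.
Qed.

Lemma dual_potential_unique y l :
  (fun N => A (glue 1 y x') + \sum_(1 <= k < N) dual_term y k) @ \oo --> l ->
  Astar y = l.
Proof. by move=> /(cvg_unique _ (dual_potential_cvg (y:=y))); apply. Qed.

Lemma dual_potential_finite y n : (0 < n)%N ->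
  (forall k, (n <= k)%N -> dual_term y k = 0) ->
  Astar y = A (glue 1 y x') + \sum_(1 <= k < n) dual_term y k.
Proof.
move=> n_gt0 T0; apply: dual_potential_unique.
rewrite -(cvg_shiftn n) /=; under eq_fun => N.
  rewrite (@big_cat_nat _ _ _ n) //=; last by rewrite leq_addl.
  rewrite [X in _ + (_ + X)]big_nat_cond [X in _ + (_ + X)]big1 ?addr0; last first.
    by move=> k /andP[/andP[le_nk _] _]; rewrite T0.
  over.
exact: cvg_cst.
Qed.

(** Term [k] is A(e^{k+1} x') - A(e^k x'), so the sum telescopes and its lower end A(e x') cancels
    the leading summand. *)
Lemma dual_sum_run y n e : (forall i, (i <= n)%N -> y i = e) ->
  A (glue 1 y x') + \sum_(1 <= k < n.+1) dual_term y k =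
  A (glue n.+1 (const_word e) x').
Proof.
move=> ye; pose F k := A (glue k (const_word e) x').
have glue_e k : (k <= n)%N -> glue k.+1 y x' = glue k.+1 (const_word e) x'.
  by move=> le_kn; apply/funext => i; rewrite !glueE; case: ltnP => // ?; rewrite ye //; lia.
have glue_te k : (k <= n)%N -> glue k (tail y) x' = glue k (const_word e) x'.
  by move=> le_kn; apply/funext => i; rewrite !glueE; case: ltnP => // ?; rewrite /tail ye //; lia.
rewrite (eq_big_nat _ _ (F2 := fun k => F k.+1 - F k)).
  by rewrite telescope_sumr // glue_e // addrC subrK.
by move=> k /andP[_ le_kn]; rewrite /dual_term glue_e // glue_te.
Qed.

(** The two points agree before position [k], where one has [y 0] and the other [x' 0]. The change
    of letter sits at positions [k - n.+1] and [k - n]; the latter reaches [k] only for [n = 0],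
    whence the alternative in the hypothesis. *)
Lemma dual_term_eq0 a b c d y n k : walters_sequences A a b c d ->
  y n.+1 = ~~ y n -> ((0 < n)%N \/ y 0%N = x' 0%N) ->
  (n.+1 < k)%N -> dual_term y k = 0.
Proof.
move=> wA yn n0 lt_nk; apply/eqP; rewrite subr_eq0; apply/eqP.
have [m_gt0 lt_mk] : (0 < k - n.+1)%N /\ (k - n.+1 < k)%N by lia.
apply: (walters_local wA m_gt0).
  rewrite !glueE; have [-> ->] : (k - n.+1 < k.+1)%N /\ ((k - n.+1).+1 < k.+1)%N by lia.
  have -> : (k.+1 - (k - n.+1).+1 = n.+1)%N by lia.
  have -> : (k.+1 - (k - n.+1).+2 = n)%N by lia.
  by rewrite yn negbK.
move=> i le_i; rewrite !glueE /tail; have -> : (i < k.+1)%N by lia.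
case: ltnP => [lt_ik|le_ki]; first by congr (y _); lia.
have [-> n_eq0] : i = k /\ n = 0%N by lia.
by rewrite !subnn; case: n0; rewrite ?n_eq0.
Qed.

End DualPotential.

(** * Values of the potential at words followed by x' = 0^alpha 1 w *)

Section ZerosOneBase.
Context {R : realType}.
Variables (A : Omega -> R) (a b c d : nat -> R) (alpha : nat) (x' : Omega).
Hypothesis wA : walters_sequences A a b c d.
Hypothesis alpha_gt0 : (0 < alpha)%N.
Hypothesis x'_lt : forall i, (i < alpha)%N -> x' i = false.
Hypothesis x'_alpha : x' alpha = true.
Implicit Types (u y : Omega) (n m : nat).

(** The zeros of [u] merge with the leading 0^alpha of [x'], which shifts the index by [alpha]. *)
Lemma value_zeros u n : (0 < n)%N -> (forall i, (i < n)%N -> u i = false) ->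
  A (glue n u x') = a (alpha + n)%N.
Proof.
move=> n_gt0 u0; rewrite (walters_first_run (e := false) (n := (alpha + n)%N) wA) //.
- by lia.
- move=> i lt_i; rewrite glueE; case: ltnP => lt_in; first by rewrite u0 //; lia.
  by rewrite x'_lt //; lia.
- by rewrite glueE ltnNge leq_addl addnK.
Qed.

Lemma value_ones u n : (1 < n)%N -> (forall i, (i < n)%N -> u i = true) ->
  A (glue n u x') = c n.
Proof.
move=> n_gt1 u1; rewrite (walters_first_run (e := true) (n := n) wA) //.
- by move=> i lt_in; rewrite glueE lt_in u1 //; lia.
- by rewrite glueE ltnn subnn x'_lt.
Qed.

Lemma value_one_zeros u n : (forall i, (i < n)%N -> u i = false) -> u n = true ->
  A (glue n.+1 u x') = d (alpha + n)%N.
Proof.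
move=> u0 un; rewrite (walters_second_run (e := true) (n := (alpha + n)%N) wA) //.
- by lia.
- by rewrite glueE subSS subn0.
- move=> i lt_i; rewrite glueE ltnS; case: ltnP => lt_in; first by rewrite u0 //; lia.
  by rewrite x'_lt //; lia.
- by rewrite glueE ltnS ltnNge leq_addl /= subSS addnK.
Qed.

Lemma value_zero_ones u n : (0 < n)%N ->
  (forall i, (i < n)%N -> u i = true) -> u n = false ->
  A (glue n.+1 u x') = b n.
Proof.
move=> n_gt0 u1 un; rewrite (walters_second_run (e := false) (n := n) wA) //.
- by rewrite glueE subSS subn0.
- by move=> i lt_in; rewrite glueE ltnS lt_in u1 //; lia.
- by rewrite glueE ltnn subnn x'_lt.
Qed.

(** The letter 1 at [u 0] separates these zeros from those of [x'], so the index is not shifted. *)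
Lemma value_zeros_one u n : (1 < n)%N ->
  (forall i, (0 < i <= n)%N -> u i = false) -> u 0%N = true ->
  A (glue n.+1 u x') = a n.
Proof.
move=> n_gt1 u0 u1; rewrite (walters_first_run (e := false) (n := n) wA) //.
- by move=> i lt_in; rewrite glueE ltnW // u0 //; lia.
- by rewrite glueE ltnSn subnn.
Qed.

Lemma value_one_zeros_one u n : (0 < n)%N ->
  u 0%N = true -> (forall i, (0 < i <= n)%N -> u i = false) -> u n.+1 = true ->
  A (glue n.+2 u x') = d n.
Proof.
move=> n_gt0 u1 u0 un; rewrite (walters_second_run (e := true) (n := n) wA) //.
- by rewrite glueE subSS subn0.
- by move=> i lt_in; rewrite glueE ltnS ltnW // u0 //; lia.
- by rewrite glueE ltnSn subnn.
Qed.

(** * Values of the dual potential by the initial runs of y *)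

Variable Astar : Omega -> R.
Hypothesis kerA : involution_kernel_exists A x'.
Hypothesis dualA : is_dual_potential A x' Astar.

(** The initial run contributes A(0^{n+1} x'); the only other surviving term is A(1 0^{n+1} x') -
    A(1 0^n x'). *)
Lemma dual_zeros_one y n : (forall i, (i <= n)%N -> y i = false) -> y n.+1 = true ->
  Astar y = a (alpha + n.+1)%N + (d (alpha + n.+1)%N - d (alpha + n)%N).
Proof.
move=> y0 yn; rewrite (dual_potential_finite kerA dualA (y := y) (n := n.+2)) //.
  rewrite big_nat_recr //= addrA (dual_sum_run _ _ y0) value_zeros // /dual_term.
  rewrite value_one_zeros // value_one_zeros // => i lt_in.
  by rewrite /tail y0.
move=> k lt_nk; apply: (dual_term_eq0 wA (n := n)) lt_nk.
  by rewrite yn y0.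
by right; rewrite y0 // x'_lt.
Qed.

Lemma dual_ones_zero y n : (0 < n)%N ->
  (forall i, (i <= n)%N -> y i = true) -> y n.+1 = false ->
  Astar y = c n.+1 + b n.+1 - b n.
Proof.
move=> n_gt0 y1 yn; rewrite (dual_potential_finite kerA dualA (y := y) (n := n.+2)) //.
  rewrite big_nat_recr //= addrA (dual_sum_run _ _ y1) value_ones // /dual_term.
  rewrite value_zero_ones // value_zero_ones ?addrA // => i lt_in.
  by rewrite /tail y1.
move=> k lt_nk; apply: (dual_term_eq0 wA (n := n)) lt_nk; last by left.
by rewrite yn y1.
Qed.

(** Term [k] is A(0^k 1 x') - A(0^k x'), with no telescoping. For [k = 1] the point 0 1 x' begins
    with a single zero, so [b 1] appears in place of an [a] value. *)
Lemma dual_sum_one_zeros y n : (0 < n)%N ->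
  y 0%N = true -> (forall i, (0 < i <= n)%N -> y i = false) ->
  A (glue 1 y x') + \sum_(1 <= k < n.+1) dual_term A x' y k =
  d alpha + (b 1%N - a alpha.+1) + \sum_(2 <= j < n.+1) (a j - a (alpha + j)%N).
Proof.
move=> n_gt0 y1 y0.
rewrite value_one_zeros // addn0 big_ltn // addrA /dual_term.
rewrite value_zero_ones //; [|by case|by rewrite y0].
rewrite value_zeros //; last by case=> // _; rewrite /tail y0.
rewrite addn1; congr (_ + _); apply: eq_big_nat => k /andP[k_gt1 le_kn].
rewrite value_zeros_one //; last by move=> i ?; rewrite y0 //; lia.
rewrite value_zeros //; first by lia.
by move=> i lt_ik; rewrite /tail y0 //; lia.
Qed.

Lemma dual_one_zeros_one y n : (0 < n)%N ->
  y 0%N = true -> (forall i, (0 < i <= n)%N -> y i = false) -> y n.+1 = true ->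
  Astar y = d alpha + (b 1%N - a alpha.+1)
    + \sum_(2 <= j < n.+1) (a j - a (alpha + j)%N) + (d n - d (alpha + n)%N).
Proof.
move=> n_gt0 y1 y0 yn; rewrite (dual_potential_finite kerA dualA (y := y) (n := n.+2)) //.
  rewrite big_nat_recr //= addrA dual_sum_one_zeros // /dual_term.
  rewrite value_one_zeros_one // value_one_zeros // => i lt_in.
  by rewrite /tail y0.
(* The change from 0 to 1 after position [n] is used; the earlier one after position 0 would require
   [y 0 = x' 0], which fails. *)
move=> k lt_nk; apply: (dual_term_eq0 wA (n := n)) lt_nk; last by left.
by rewrite yn y0 // n_gt0 leqnn.
Qed.

Lemma dual_zeros l : a @ \oo --> l -> Astar (const_word false) = l.
Proof.
move=> al; apply: (dual_potential_unique kerA dualA).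
rewrite -cvg_shiftS /=; under eq_fun => N do
  rewrite (dual_sum_run _ _ (e := false)) // value_zeros // addnC addSnnS.
by move: al; rewrite -(cvg_shiftn alpha.+1).
Qed.

Lemma dual_ones l : c @ \oo --> l -> Astar (const_word true) = l.
Proof.
move=> cl; apply: (dual_potential_unique kerA dualA).
(* The shift by two makes the run length [N + 2] exceed one, as [value_ones] requires. *)
rewrite -(cvg_shiftn 2) /=; under eq_fun => N do
  rewrite addn2 (dual_sum_run _ _ (e := true)) // value_ones // -addn2.
by move: cl; rewrite -(cvg_shiftn 2).
Qed.

(** Convergence is inherited from the kernel series, not deduced from the convergence of [a]. Stated
    as a limit, it yields both the convergence and the value of the series. *)
Lemma dual_one_zeros y : y 0%N = true -> (forall i, y i.+1 = false) ->
  (fun N => \sum_(2 <= j < N) (a j - a (alpha + j)%N)) @ \oo -->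
  Astar y - (d alpha + (b 1%N - a alpha.+1)).
Proof.
move=> y1 y0; have := dual_potential_cvg kerA dualA (y := y).
rewrite -(cvg_shiftn 2) /= => sum_cvg; rewrite -(cvg_shiftn 2) /=.
set K := d alpha + _; apply: cvg_trans (cvgB sum_cvg (cvg_cst K)).
apply: near_eq_cvg; apply: nearW => N.
have y0_pos i : (0 < i <= N.+1)%N -> y i = false by case: i.
by rewrite /= !fctE addn2 (dual_sum_one_zeros (n := N.+1)) // addrAC subrr add0r.
Qed.

End ZerosOneBase.

Theorem mainTheorem6 (R : realType) (A : Omega -> R)
    (a b c d : nat -> R) (la lb lc ld : R) (alpha : nat) (w : Omega)
    (Astar : Omega -> R) :
  let x' := prepend (nseq alpha false ++ [:: true]) w in
  walters_family A ->
  walters_sequences A a b c d ->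
  a @ \oo --> la -> b @ \oo --> lb -> c @ \oo --> lc -> d @ \oo --> ld ->
  (0 < alpha)%N ->
  involution_kernel_exists A x' ->
  is_dual_potential A x' Astar ->
  (forall (n : nat) (z : Omega), (0 < n)%N ->
     [/\ Astar (prepend (nseq n.+1 false ++ [:: true]) z) =
           a (alpha + n.+1)%N + (d (alpha + n.+1)%N - d (alpha + n)%N),
         Astar (prepend (false :: nseq n true ++ [:: false]) z) =
           a alpha.+1 + (d alpha.+1 - d alpha),
         Astar (prepend (nseq n.+1 true ++ [:: false]) z) =
           c n.+1 + b n.+1 - b n &
         Astar (prepend (true :: nseq n false ++ [:: true]) z) =
           d alpha + (b 1%N - a alpha.+1)
           + \sum_(2 <= j < n.+1) (a j - a (alpha + j)%N)
           + (d n - d (alpha + n)%N)]) /\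
  [/\ Astar (const_word false) = la,
      Astar (prepend [:: false] (const_word true)) =
        a alpha.+1 + (d alpha.+1 - d alpha),
      Astar (const_word true) = lc,
      cvgn (fun N => \sum_(2 <= j < N) (a j - a (alpha + j)%N)) &
      Astar (prepend [:: true] (const_word false)) =
        d alpha + (b 1%N - a alpha.+1)
        + limn (fun N => \sum_(2 <= j < N) (a j - a (alpha + j)%N))].
Proof.
move=> x' _ wA cvg_a _ cvg_c _ alpha_gt0 kerA dualA.
have [x'_lt x'_alpha] := prepend_runE alpha false w.
split=> [n z n_gt0|].
  split.
  - have [y0 yn] := prepend_runE n.+1 false z.
    exact: (dual_zeros_one wA alpha_gt0 x'_lt x'_alpha kerA dualA).
  (* With [n = 0] the initial run is a single zero: the value is the same for every [y] starting
     with 01, which also settles 0 1^oo below. *)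
  - rewrite (dual_zeros_one wA alpha_gt0 x'_lt x'_alpha kerA dualA (n := 0)).
    + by rewrite addn0 addn1.
    + by case.
    + by case: n n_gt0.
  - have [y1 yn] := prepend_runE n.+1 true z.
    exact: (dual_ones_zero wA alpha_gt0 x'_lt x'_alpha kerA dualA n_gt0 y1 yn).
  - have [y0 yn] := prepend_runE n false z.
    apply: (dual_one_zeros_one wA alpha_gt0 x'_lt x'_alpha kerA dualA) => //.
    by case=> // i; exact: y0.
have sum_cvg := dual_one_zeros wA alpha_gt0 x'_lt x'_alpha kerA dualA
  (y := prepend [:: true] (const_word false)) (erefl _) (fun=> erefl _).
split.
- exact: (dual_zeros wA alpha_gt0 x'_lt x'_alpha kerA dualA).
- rewrite (dual_zeros_one wA alpha_gt0 x'_lt x'_alpha kerA dualA (n := 0)) //.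
    by rewrite addn0 addn1.
  by case.
- exact: (dual_ones wA alpha_gt0 x'_lt x'_alpha kerA dualA).
- by apply/cvg_ex; eexists; exact: sum_cvg.
- by rewrite (cvg_lim _ sum_cvg) // addrC subrK.
Qed.
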